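(* Let $r,s,l,h\ge 0$ be integers and let $a_1,\dots,a_r,\ b_1,\dots,b_s,\ c_1,\dots,c_l,\ d_1,\dots,d_h$ be complex parameters not depending on the degree index (arbitrary, subject only to the convention that the expressions below are well defined). Then for every integer $n\ge 0$ the following two identities of polynomials in $x$ hold. (Inversion formula) $$x^n=\frac{[b_s;q]_n}{[a_r;q]_n}\left((-1)^nq^{\frac{n(n-1)}{2}}\right)^{r-s}\sum_{k=0}^n(-1)^k{n\brack k}_q\,q^{\frac{k(k-1)}{2}}\; {}_{r+1}\phi_{s}\!\left(\begin{matrix}q^{-k},\,(a_r)\\ (b_s)\end{matrix};q;qx\right).$$ (Connection formula) $$\begin{aligned} {}_{r+1}\phi_{s}\!\left(\begin{matrix}q^{-n},\,(a_r)\\ (b_s)\end{matrix};q;qx\right)=\sum_{m=0}^n&\;{n\brack m}_q(-1)^{m(s+l-r-h)}\,q^{\frac{m(m-1)}{2}(s+l-r-h)}\,q^{m(m-n)}\,\frac{[a_r;q]_m}{[b_s;q]_m}\,\frac{[d_h;q]_m}{[c_l;q]_m}\\ &\times {}_{r+h+1}\phi_{s+l}\!\left(\begin{matrix}q^{m-n},\,(a_rq^m),\,(d_hq^m)\\ (b_sq^m),\,(c_lq^m)\end{matrix};q;q^{1+m(s+l-r-h)}\right)\\ &\times {}_{l+1}\phi_{h}\!\left(\begin{matrix}q^{-m},\,(c_l)\\ (d_h)\end{matrix};q;qx\right). \end{aligned}$$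
   Context: Notation. $q$ is the base, a nonzero complex number. The $q$-shifted factorial is $(x;q)_0=1$ and $(x;q)_n=\prod_{k=0}^{n-1}(1-xq^k)$ for $n\ge 1$. The $q$-binomial coefficient is ${n\brack k}_q=\dfrac{(q;q)_n}{(q;q)_k(q;q)_{n-k}}$. The symbol $(a_r)$ abbreviates the list of $r$ parameters $a_1,\dots,a_r$, and $(a_rq^m)$ abbreviates the list $a_1q^m,\dots,a_rq^m$; similarly for $(b_s)$, $(c_l)$, $(d_h)$. The product notation is $[a_r;q]_k=(a_1;q)_k(a_2;q)_k\cdots(a_r;q)_k$, with the empty product equal to $1$; similarly for $[b_s;q]_k$, $[c_l;q]_k$, $[d_h;q]_k$. The basic hypergeometric series with $r$ upper and $s$ lower parameters is $${}_r\phi_s\!\left(\begin{matrix}(a_r)\\(b_s)\end{matrix};q;z\right)=\sum_{k=0}^\infty\frac{[a_r;q]_k}{[b_s;q]_k}\left((-1)^kq^{\frac{k(k-1)}{2}}\right)^{1+s-r}\frac{z^k}{(q;q)_k}.$$ All series in the claim terminate, because they have an upper parameter $q^{-N}$ with $N\ge0$ an integer (so that only the terms $0\le k\le N$ contribute); hence they are finite sums. Convention: the parameters and $q$ are such that no denominator vanishes. That is, $(q;q)_n\neq0$; in the inversion formula $[a_r;q]_n\neq0$ and $[b_s;q]_n\neq0$; in the connection formula $[b_s;q]_n$, $[c_l;q]_n$ and $[d_h;q]_n$ are all nonzero. *)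

(* Defs.v *)
From mathcomp Require Import all_boot all_order all_algebra.
From mathcomp Require Import complex.
From mathcomp Require Import all_classical all_reals all_analysis.

Set Implicit Arguments.
Unset Strict Implicit.
Unset Printing Implicit Defensive.

Import Order.TTheory GRing.Theory Num.Theory.
Import numFieldNormedType.Exports.

Local Open Scope ring_scope.

(* The definitions are over an arbitrary numFieldType because an abstract
   K : numFieldType carries its norm topology, whereas the topology of R[i]
   is not inferred directly; they are meant to be used with K := R[i]. *)

Definition qpoch (K : numFieldType) (x q : K) (n : nat) : K :=
  \prod_(k < n) (1 - x * q ^+ k).

Definition qpochs (K : numFieldType) (a : seq K) (q : K) (n : nat) : K :=
  \prod_(x <- a) qpoch x q n.

Definition qbinom (K : numFieldType) (q : K) (n k : nat) : K :=
  qpoch q q n / (qpoch q q k * qpoch q q (n - k)).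

Definition qshift (K : numFieldType) (a : seq K) (q : K) (m : nat) : seq K :=
  [seq x * q ^+ m | x <- a].

Definition qsign (K : numFieldType) (q : K) (k : nat) : K :=
  (-1) ^+ k * q ^+ (k * k.-1)./2.

(* Since 0^-1 = 0, every term beyond the terminating index of a series with an
   upper parameter q^-N is 0, even if one of its denominators vanishes. *)
Definition qhyper_term (K : numFieldType) (a b : seq K) (q z : K) (k : nat) : K :=
  qpochs a q k / qpochs b q k
  * qsign q k ^ (1 + (size b)%:Z - (size a)%:Z)
  * (z ^+ k / qpoch q q k).

Definition qhyper (K : numFieldType) (a b : seq K) (q z : K) : K :=
  limn (series (qhyper_term a b q z)).

(* Main.v *)
Require Import Defs.
From mathcomp Require Import all_boot all_order all_algebra.
From mathcomp Require Import complex.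
From mathcomp Require Import all_classical all_reals all_analysis.
From mathcomp Require Import zify ring.

(** Write [u k] for [qhyper_coef a b q k]. Reversing the product
    [qpoch (q ^- n) q k] gives a q-binomial coefficient ([qpoch_qVn]), so the
    terminating series of argument [q * x] is
      [\sum_(k <= n) qbinom q n k * qsign q k * q ^+ k / q ^+ (n * k)
                      * (u k * x ^+ k)],
    that is, the image of the sequence [k |-> u k * x ^+ k] under a lower
    triangular kernel which does not involve the parameters.

    This kernel is inverted by [k |-> qbinom q n k * qsign q k]
    ([qbinomial_inversion]): up to the trinomial identity for q-binomial
    coefficients, the product of the two kernels is the alternating sum
    [\sum_(i <= n) qbinom q n i * qsign q i], which telescopes to 0 for
    [n > 0]. Dividing the inverted relation by [u n] is the inversion formula.

    For the connection formula, apply the inversion formula with parameters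
    [c] and [d] to every power of [x] in the series with parameters [a] and
    [b]. The coefficient of the series of index [m] is then a sum over
    [k = m + i]; splitting all shifted factorials at [m]
    ([qhyper_coef_ratioD]) turns it into a terminating series in [i] with
    parameters multiplied by [q ^+ m].

    Topology enters only through the limits defining the series; as these
    terminate, the limits are finite sums ([limn_series_finite]). *)

Set Implicit Arguments.
Unset Strict Implicit.
Unset Printing Implicit Defensive.

Import Order.TTheory GRing.Theory Num.Theory.
Import numFieldNormedType.Exports.

Local Open Scope ring_scope.

(** * Shifted factorials and the sign factor *)

Section QSeries.
Variable K : numFieldType.
Implicit Types (x q z : K) (a b c d : seq K).

Lemma qpoch0 x q : qpoch x q 0 = 1.
Proof. by rewrite /qpoch big_ord0. Qed.

Lemma qpochS x q n : qpoch x q n.+1 = qpoch x q n * (1 - x * q ^+ n).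
Proof. by rewrite /qpoch big_ord_recr. Qed.

Lemma qpochD x q m n :
  qpoch x q (m + n) = qpoch x q m * qpoch (x * q ^+ m) q n.
Proof.
rewrite /qpoch big_split_ord /=; congr (_ * _).
by apply: eq_bigr => i _; rewrite exprD mulrA.
Qed.

Lemma qpoch_neq0_leq x q m n :
  (m <= n)%N -> qpoch x q n != 0 -> qpoch x q m != 0.
Proof. by move=> /subnKC <-; rewrite qpochD mulf_eq0 => /norP[]. Qed.

Lemma qpochs_cons x a q n : qpochs (x :: a) q n = qpoch x q n * qpochs a q n.
Proof. by rewrite /qpochs big_cons. Qed.

Lemma qpochs_cat a b q n : qpochs (a ++ b) q n = qpochs a q n * qpochs b q n.
Proof. by rewrite /qpochs big_cat. Qed.

Lemma qpochsD a q m n :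
  qpochs a q (m + n) = qpochs a q m * qpochs (qshift a q m) q n.
Proof.
rewrite /qpochs /qshift big_map -big_split /=.
by apply: eq_bigr => x _; rewrite qpochD.
Qed.

Lemma qpochs_neq0_leq a q m n :
  (m <= n)%N -> qpochs a q n != 0 -> qpochs a q m != 0.
Proof. by move=> /subnKC <-; rewrite qpochsD mulf_eq0 => /norP[]. Qed.

Lemma half_mulSn n : (n.+1 * n)./2 = ((n * n.-1)./2 + n)%N.
Proof. by case: n => // n; rewrite -!bin2 binS bin1. Qed.

Lemma qsignS q n : qsign q n.+1 = - (qsign q n * q ^+ n).
Proof. by rewrite /qsign half_mulSn exprS exprD; ring. Qed.

Lemma qsignD q m n : qsign q (m + n) = qsign q m * qsign q n * q ^+ (m * n).
Proof.
elim: n => [|n IH]; first by rewrite addn0 muln0 /qsign !expr0 !mulr1.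
by rewrite addnS !qsignS IH mulnS !exprD; ring.
Qed.

Lemma qsign_neq0 q n : q != 0 -> qsign q n != 0.
Proof. by move=> q0; rewrite mulf_neq0 // expf_neq0 // oppr_eq0 oner_eq0. Qed.

Lemma qsign_expz q m (e : int) :
  qsign q m ^ e = (-1) ^ (m%:Z * e) * q ^ ((m * m.-1)./2%:Z * e).
Proof. by rewrite /qsign expfzMl !exprnP !exprz_exp. Qed.

(** Accounts for all cancellations of powers of [q] below: two sign factors
    of the same index meet the [q ^+ n / q ^+ (n * n)] of a terminating
    series. *)
Lemma qsign_sqr q n : qsign q n * qsign q n * q ^+ n = q ^+ (n * n).
Proof.
elim: n => [|n IH]; first by rewrite /qsign !expr0 !mulr1.
rewrite qsignS mulSn mulnS !exprD -IH !exprS; ring.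
Qed.

(** Reversing the product: [1 - q ^- (k + m) * q ^+ j] equals
    [1 - q ^+ (k + m - j)] up to the monomial factor [- q ^+ j / q ^+ (k + m)].
    Written without division so that an induction on [k] closes. *)
Lemma qpoch_qVn_addn q k m : q != 0 ->
  qpoch (q ^- (k + m)) q k * qpoch q q m * q ^+ ((k + m) * k)
  = qpoch q q (k + m) * qsign q k.
Proof.
move=> q0; elim: k m => [|k IH] m.
  by rewrite !qpoch0 muln0 /qsign !expr0 !mulr1 mul1r.
rewrite qpochS qsignS.
have := IH m.+1; rewrite qpochS addnS -addSn -exprS => IHm.
have -> : qpoch q q (k.+1 + m) * - (qsign q k * q ^+ k) =
   - (q ^+ k) * (qpoch q q (k.+1 + m) * qsign q k) by ring.
rewrite -IHm mulnS [q ^+ (_ + _ * k)]exprD.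
have Ek : q ^+ (k.+1 + m) = q ^+ k * q ^+ m.+1 by rewrite addSn -addnS exprD.
have := expf_neq0 k q0; have := expf_neq0 m.+1 q0.
rewrite Ek => Hm Hk.
by field; rewrite Hm Hk.
Qed.

(** This is what makes the series terminate: the factor of index [n] is
    [1 - q ^- n * q ^+ n]. *)
Lemma qpoch_qVn_gt q n k : q != 0 -> (n < k)%N -> qpoch (q ^- n) q k = 0.
Proof.
move=> q0 /subnKC <-; rewrite qpochD qpochS mulVf ?expf_neq0 //.
by rewrite subrr mulr0 mul0r.
Qed.

(** The quotient by [qpoch q q k] is the one occurring in the terms of a
    series. *)
Lemma qpoch_qVn q n k : q != 0 -> qpoch q q n != 0 -> (k <= n)%N ->
  qpoch (q ^- n) q k / qpoch q q k = qbinom q n k * qsign q k / q ^+ (n * k).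
Proof.
move=> q0 qn kn; rewrite /qbinom -{1 2 4}(subnKC kn).
have Hk := qpoch_neq0_leq kn qn.
have Hm := qpoch_neq0_leq (leq_subr k n) qn.
have Hq := expf_neq0 ((k + (n - k)) * k)%N q0.
have := qpoch_qVn_addn k (n - k) q0.
move: Hk Hm Hq.
set A := qpoch (q ^- _) _ _; set B := qpoch q q (n - k); set C := q ^+ (_ * _).
set D := qpoch q q (k + _); set E := qsign _ _; set F := qpoch q q k.
move=> Hk Hm Hq E1.
have -> : A = D * E / (B * C) by rewrite -E1; field; rewrite Hm Hq.
by field; rewrite Hk Hm Hq.
Qed.

(** * Terminating series as finite sums *)

Lemma limn_series_finite (u : nat -> K) N :
  (forall k, (N < k)%N -> u k = 0) -> limn (series u) = \sum_(k < N.+1) u k.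
Proof.
move=> u0.
(* [K^o] is [K] seen as a normed space over itself, hence a Hausdorff space. *)
apply: (@lim_near_cst K^o); first exact: norm_hausdorff.
exists N.+1 => // n /= Nn.
rewrite /series /= (big_cat_nat (n := N.+1)) //= big_mkord.
rewrite [X in _ + X]big_nat_cond [X in _ + X]big1 ?addr0 // => i.
by rewrite andbT => /andP[/u0].
Qed.

(** The part of the [k]-th term that does not depend on the terminating
    parameter: the exponent of the sign factor is the one of a series having
    one more upper parameter than [a]. *)
Definition qhyper_coef a b q k : K :=
  qpochs a q k / qpochs b q k * qsign q k ^ ((size b)%:Z - (size a)%:Z).

(** The series is the transform of [k |-> qhyper_coef a b q k * z ^+ k] by a
    triangular kernel that depends on [n], [k] and [q] only. *)
Lemma qhyper_terminating q n a b z : q != 0 -> qpoch q q n != 0 ->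
  qhyper (q ^- n :: a) b q z =
  \sum_(k < n.+1) qbinom q n k * qsign q k / q ^+ (n * k)
    * (qhyper_coef a b q k * z ^+ k).
Proof.
move=> q0 qn; rewrite /qhyper (limn_series_finite (N := n)); last first.
  by move=> k nk; rewrite /qhyper_term qpochs_cons qpoch_qVn_gt // !mul0r.
apply: eq_bigr => k _; rewrite /qhyper_term qpochs_cons.
rewrite /qhyper_coef -qpoch_qVn //; last by rewrite -ltnS.
have -> : 1 + (size b)%:Z - (size (q ^- n :: a))%:Z
  = (size b)%:Z - (size a)%:Z by rewrite /= -addn1 PoszD; ring.
ring.
Qed.

(** * Orthogonality of the q-binomial coefficients *)

Lemma sum_triangle (V : nmodType) n (F : nat -> nat -> V) :
  \sum_(k < n.+1) \sum_(j < k.+1) F k j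
  = \sum_(j < n.+1) \sum_(i < (n - j).+1) F (j + i)%N j.
Proof.
elim: n => [|n IH]; first by rewrite !big_ord1.
rewrite big_ord_recr /= IH [in RHS]big_ord_recr /= subnn big_ord1 addn0.
rewrite [X in _ + X = _]big_ord_recr /= addrA; congr (_ + _).
rewrite -big_split /=; apply: eq_bigr => j _.
have jn : (j <= n)%N by rewrite -ltnS.
by rewrite (subSn jn) [in RHS]big_ord_recr /= addnS subnKC.
Qed.

Section Qbinom.
Variables (q : K) (n : nat).
Hypothesis qn : qpoch q q n != 0.

Lemma qbinom0 : qbinom q n 0 = 1.
Proof. by rewrite /qbinom qpoch0 mul1r subn0 divff. Qed.

Lemma qbinomn : qbinom q n n = 1.
Proof. by rewrite /qbinom subnn qpoch0 mulr1 divff. Qed.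

Lemma qbinom_trinomial j i : (j + i <= n)%N ->
  qbinom q n (j + i) * qbinom q (j + i) j = qbinom q n j * qbinom q (n - j) i.
Proof.
move=> le; rewrite /qbinom addKn subnDA.
have H1 := qpoch_neq0_leq le qn.
have H2 := qpoch_neq0_leq (leq_subr j n) qn.
have H3 := qpoch_neq0_leq (leq_trans (leq_addr _ _) le) qn.
have H4 := qpoch_neq0_leq (leq_trans (leq_addl _ _) le) qn.
have H5 : qpoch q q (n - j - i) != 0.
  by rewrite -subnDA (qpoch_neq0_leq (leq_subr _ _) qn).
by field; rewrite H1 H2 H3 H4 H5.
Qed.

End Qbinom.

(** The bound on [k] matters because [qbinom] is defined with truncated
    subtraction, hence does not vanish above the diagonal. *)
Lemma qbinom_pascal q n k : qpoch q q n.+1 != 0 -> (k < n)%N ->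
  qbinom q n.+1 k.+1 = qbinom q n k + q ^+ k.+1 * qbinom q n k.+1.
Proof.
move=> qn kn; rewrite /qbinom subSS -(subnKC kn).
set m := (n - k.+1)%N.
have -> : (k.+1 + m - k)%N = m.+1 by lia.
have -> : (k.+1 + m - k.+1)%N = m by lia.
have Em : (k.+1 + m = n)%N by rewrite /m; lia.
have H1 : qpoch q q k.+1 != 0 by apply: (qpoch_neq0_leq _ qn); lia.
have H2 : qpoch q q m.+1 != 0 by apply: (qpoch_neq0_leq _ qn); lia.
move: H1 H2; rewrite (qpochS _ _ (k.+1 + m)) !qpochS !mulf_eq0 -!exprS.
move=> /norP[H1 H2] /norP[H3 H4].
rewrite -addnS exprD.
by field; rewrite H1 H2 H3 H4.
Qed.

(** By the Pascal rule and [qsignS], for [0 < k] the last term of the sum is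
    the difference of the right-hand sides at [k] and [k.-1]. *)
Lemma sum_qbinom_qsign_partial q n k : qpoch q q n.+1 != 0 -> (k <= n)%N ->
  \sum_(i < k.+1) qbinom q n.+1 i * qsign q i
  = qbinom q n k * qsign q k * q ^+ k.
Proof.
move=> qn; have qn' := qpoch_neq0_leq (leqnSn n) qn.
elim: k => [|k IH] kn.
  by rewrite big_ord1 !qbinom0 // expr0 mulr1.
rewrite big_ord_recr /= IH ?(ltnW kn) // qbinom_pascal // qsignS; ring.
Qed.

(** The q-binomial theorem for [qpoch 1 q n], whose first factor is zero
    unless [n = 0]. *)
Lemma sum_qbinom_qsign q n : qpoch q q n != 0 ->
  \sum_(i < n.+1) qbinom q n i * qsign q i = (n == 0)%:R.
Proof.
case: n => [|n] qn.
  by rewrite big_ord1 qbinom0 // /qsign !expr0 !mulr1.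
rewrite big_ord_recr /= sum_qbinom_qsign_partial // !qbinomn //.
  by rewrite qsignS !mul1r subrr.
exact: qpoch_neq0_leq (leqnSn n) qn.
Qed.

(** The triangular kernel of a terminating series has an explicit inverse:
    after exchanging the sums, the trinomial identity pulls [qbinom q n j] out
    of the coefficient of [f j], and what is left is the alternating sum
    [sum_qbinom_qsign] of length [n - j], which kills every [j < n]. *)
Lemma qbinomial_inversion q n (f : nat -> K) : q != 0 -> qpoch q q n != 0 ->
  \sum_(k < n.+1) qbinom q n k * qsign q k *
     \sum_(j < k.+1) qbinom q k j * qsign q j / q ^+ (k * j) * q ^+ j * f j
  = f n.
Proof.
move=> q0 qn.
under eq_bigr do rewrite big_distrr /=.
rewrite (sum_triangle n (fun k j => qbinom q n k * qsign q k *
  (qbinom q k j * qsign q j / q ^+ (k * j) * q ^+ j * f j))).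
have inner (j : 'I_n.+1) :
    \sum_(i < (n - j).+1) qbinom q n (j + i) * qsign q (j + i) *
     (qbinom q (j + i) j * qsign q j / q ^+ ((j + i) * j) * q ^+ j * f j)
  = qbinom q n j * f j * (n - j == 0)%N%:R.
  have jn : (j <= n)%N by rewrite -ltnS.
  rewrite -(sum_qbinom_qsign (qpoch_neq0_leq (leq_subr j n) qn)).
  rewrite big_distrr /=; apply: eq_bigr => i _.
  have ijn : (j + i <= n)%N by have := ltn_ord i; lia.
  transitivity (qbinom q n (j + i) * qbinom q (j + i) j * f j * qsign q i *
    (qsign q j * qsign q j * q ^+ j * q ^+ (j * i) / q ^+ ((j + i) * j))).
    by rewrite qsignD; ring.
  rewrite qbinom_trinomial // qsign_sqr -exprD -mulnDr [(_ * j)%N]mulnC.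
  by rewrite divff ?expf_neq0 //; ring.
under eq_bigr do rewrite inner.
rewrite big_ord_recr /= subnn eqxx mulr1 qbinomn // mul1r.
rewrite big1 ?add0r // => j _.
by rewrite subn_eq0 leqNgt ltn_ord mulr0.
Qed.

(** * Inversion and connection *)

Lemma qhyper_qxE q n a b x : q != 0 -> qpoch q q n != 0 ->
  qhyper (q ^- n :: a) b q (q * x) =
  \sum_(k < n.+1) qbinom q n k * qsign q k / q ^+ (n * k) * q ^+ k
    * (qhyper_coef a b q k * x ^+ k).
Proof.
move=> q0 qn; rewrite qhyper_terminating //; apply: eq_bigr => k _.
by rewrite exprMn; ring.
Qed.

Lemma qhyper_inversion q n a b x : q != 0 -> qpoch q q n != 0 ->
  \sum_(k < n.+1) qbinom q n k * qsign q k * qhyper (q ^- k :: a) b q (q * x)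
  = qhyper_coef a b q n * x ^+ n.
Proof.
move=> q0 qn.
pose f k := qhyper_coef a b q k * x ^+ k.
rewrite -[RHS]/(f n) -(qbinomial_inversion f q0 qn).
apply: eq_bigr => k _; rewrite qhyper_qxE //.
by apply: (qpoch_neq0_leq _ qn); rewrite -ltnS.
Qed.

Lemma qhyper_coef_neq0 q n a b : q != 0 ->
  qpochs a q n != 0 -> qpochs b q n != 0 -> qhyper_coef a b q n != 0.
Proof.
by move=> q0 an bn; rewrite !mulf_neq0 ?invr_eq0 // expfz_neq0 ?qsign_neq0.
Qed.

(** The origin of the shifted parameters in the connection coefficients: the
    shifted factorials split at index [m], and the cross term [q ^+ (m * i)]
    of [qsignD], raised to the power [e], becomes a power of the argument of
    the inner series. *)
Lemma qhyper_coef_ratioD q a b c d m i : q != 0 ->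
  let e : int := (size b)%:Z + (size c)%:Z - (size a)%:Z - (size d)%:Z in
  qhyper_coef a b q (m + i) / qhyper_coef c d q (m + i) =
  qpochs a q m / qpochs b q m * (qpochs d q m / qpochs c q m) * qsign q m ^ e
  * (qhyper_coef (qshift a q m ++ qshift d q m)
                 (qshift b q m ++ qshift c q m) q i * (q ^ (m%:Z * e)) ^+ i).
Proof.
move=> q0 e; rewrite /qhyper_coef.
have -> : (size (qshift b q m ++ qshift c q m))%:Z
   - (size (qshift a q m ++ qshift d q m))%:Z = e.
  by rewrite !size_cat !size_map !PoszD /e; ring.
rewrite !qpochs_cat.
have s0 := qsign_neq0 (m + i) q0.
have Ee : qsign q (m + i) ^ ((size b)%:Z - (size a)%:Z)
   / qsign q (m + i) ^ ((size d)%:Z - (size c)%:Z)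
   = qsign q m ^ e * qsign q i ^ e * (q ^ (m%:Z * e)) ^+ i.
  rewrite invr_expz -expfzDr //.
  have -> : (size b)%:Z - (size a)%:Z - ((size d)%:Z - (size c)%:Z) = e.
    by rewrite /e; ring.
  rewrite qsignD !expfzMl; congr (_ * _).
  by rewrite !exprnP !exprz_exp; congr (_ ^ _); rewrite PoszM mulrAC.
rewrite invfM mulrACA Ee !qpochsD !invfM !invrK; ring.
Qed.

(** Expand the left-hand side in powers of [x], replace each [x ^+ k] by its
    expansion in the series with parameters [c] and [d], and collect the terms
    of index [k = m + i]: for fixed [m] the sum over [i] is again a terminating
    series, with parameters shifted by [q ^+ m]. *)
Lemma qhyper_connection q n a b c d x : q != 0 -> qpoch q q n != 0 ->
  qpochs c q n != 0 -> qpochs d q n != 0 ->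
  let e : int := (size b)%:Z + (size c)%:Z - (size a)%:Z - (size d)%:Z in
  qhyper (q ^- n :: a) b q (q * x) =
  \sum_(m < n.+1) qbinom q n m * qsign q m ^ e * q ^ (m%:Z * (m%:Z - n%:Z))
    * (qpochs a q m / qpochs b q m) * (qpochs d q m / qpochs c q m)
    * qhyper (q ^- (n - m) :: qshift a q m ++ qshift d q m)
             (qshift b q m ++ qshift c q m) q (q ^ (1 + m%:Z * e))
    * qhyper (q ^- m :: c) d q (q * x).
Proof.
move=> q0 qn cn dn e; rewrite qhyper_qxE //.
(* The term of the double sum, with [k] the power of [x] being expanded. *)
pose G k m := qbinom q n k * qsign q k / q ^+ (n * k) * q ^+ k
   * (qhyper_coef a b q k / qhyper_coef c d q k)
   * (qbinom q k m * qsign q m * qhyper (q ^- m :: c) d q (q * x)).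
transitivity (\sum_(k < n.+1) \sum_(m < k.+1) G k m).
  apply: eq_bigr => k _; have kn : (k <= n)%N by rewrite -ltnS.
  rewrite /G -big_distrr /= qhyper_inversion ?(qpoch_neq0_leq kn qn) //.
  have v0 : qhyper_coef c d q k != 0.
    by rewrite qhyper_coef_neq0 // (qpochs_neq0_leq kn).
  by field; rewrite v0 expf_neq0.
rewrite (sum_triangle n G); apply: eq_bigr => m _.
have mn : (m <= n)%N by rewrite -ltnS.
rewrite qhyper_terminating ?(qpoch_neq0_leq (leq_subr m n) qn) //.
rewrite big_distrr big_distrl /=; apply: eq_bigr => i _.
have imn : (m + i <= n)%N by have := ltn_ord i; lia.
rewrite /G qhyper_coef_ratioD // -/e.
have -> : (q ^ (1 + m%:Z * e)) ^+ i = q ^+ i * (q ^ (m%:Z * e)) ^+ i.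
  by rewrite expfzDr // exprMn expr1z.
(* The powers of [q] match because [qsign q m] occurs twice. *)
have Epow : qsign q m * qsign q (m + i) / q ^+ (n * (m + i)) * q ^+ (m + i)
  = q ^ (m%:Z * (m%:Z - n%:Z)) * (qsign q i / q ^+ ((n - m) * i) * q ^+ i).
  have -> : m%:Z * (m%:Z - n%:Z) = (m * m)%:Z - (n * m)%:Z.
    by rewrite !PoszM; ring.
  rewrite expfzDr // -invr_expz -!exprnP qsignD mulnDr !exprD.
  have -> : (n * i = m * i + (n - m) * i)%N by rewrite -mulnDl subnKC.
  rewrite -qsign_sqr !exprD.
  have N1 := expf_neq0 (n * m) q0.
  have N2 := expf_neq0 (m * i) q0.
  have N3 := expf_neq0 ((n - m) * i) q0.
  by field; rewrite N1 N2 N3.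
have tri := qbinom_trinomial qn imn.
transitivity (qbinom q n (m + i) * qbinom q (m + i) m
  * (qsign q m * qsign q (m + i) / q ^+ (n * (m + i)) * q ^+ (m + i))
  * (qpochs a q m / qpochs b q m * (qpochs d q m / qpochs c q m) * qsign q m ^ e
  * (qhyper_coef (qshift a q m ++ qshift d q m)
                 (qshift b q m ++ qshift c q m) q i * (q ^ (m%:Z * e)) ^+ i))
  * qhyper (q ^- m :: c) d q (q * x)); first by ring.
rewrite tri Epow; ring.
Qed.

End QSeries.

Theorem corollary2p3 (R : realType) (q : R[i]) (r s l h : nat)
  (a : r.-tuple R[i]) (b : s.-tuple R[i])
  (c : l.-tuple R[i]) (d : h.-tuple R[i]) (n : nat)
  (hq : q != 0) (hqn : qpoch q q n != 0) :
  (qpochs a q n != 0 -> qpochs b q n != 0 ->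
   forall x : R[i],
   x ^+ n =
     qpochs b q n / qpochs a q n * qsign q n ^ (r%:Z - s%:Z)
     * \sum_(k < n.+1)
         (-1) ^+ k * qbinom q n k * q ^+ (k * k.-1)./2
         * qhyper (q ^- k :: a) b q (q * x))
  /\
  (qpochs b q n != 0 -> qpochs c q n != 0 -> qpochs d q n != 0 ->
   forall x : R[i],
   qhyper (q ^- n :: a) b q (q * x) =
     \sum_(m < n.+1)
       qbinom q n m
       * (-1) ^ (m%:Z * (s%:Z + l%:Z - r%:Z - h%:Z))
       * q ^ ((m * m.-1)./2%:Z * (s%:Z + l%:Z - r%:Z - h%:Z))
       * q ^ (m%:Z * (m%:Z - n%:Z))
       * (qpochs a q m / qpochs b q m)
       * (qpochs d q m / qpochs c q m)
       * qhyper (q ^ (m%:Z - n%:Z) :: qshift a q m ++ qshift d q m)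
                (qshift b q m ++ qshift c q m) q
                (q ^ (1 + m%:Z * (s%:Z + l%:Z - r%:Z - h%:Z)))
       * qhyper (q ^- m :: c) d q (q * x)).
Proof.
split=> [an bn x | bn cn dn x].
  have -> : \sum_(k < n.+1) (-1) ^+ k * qbinom q n k * q ^+ (k * k.-1)./2
                * qhyper (q ^- k :: a) b q (q * x)
          = qhyper_coef a b q n * x ^+ n.
    rewrite -qhyper_inversion //.
    by apply: eq_bigr => k _; rewrite /qsign; ring.
  rewrite /qhyper_coef !size_tuple -opprB -invr_expz.
  have s0 : qsign q n ^ (s%:Z - r%:Z) != 0 by rewrite expfz_neq0 ?qsign_neq0.
  by field; rewrite an bn s0.
rewrite (qhyper_connection a b x hq hqn cn dn) !size_tuple.
apply: eq_bigr => m _; have mn : (m <= n)%N by rewrite -ltnS.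
have -> : q ^ (m%:Z - n%:Z) = q ^- (n - m).
  by rewrite -opprB subzn // -invr_expz.
by rewrite qsign_expz !mulrA.
Qed.
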